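(* Let $(\sigma,\sigma_T)$ be a bounded vocabulary, let $c_1,\ldots,c_m$ be constant symbols, and let $\mathcal{C}$ be either the class of all $m$-pointed $\sigma$-structures or the class of all finite $m$-pointed $\sigma$-structures. For any first-order sentence $\varphi$ over $\sigma\cup\{c_1,\ldots,c_m\}$ the following are equivalent: (1) there is $k>0$ such that for all $(\mathcal{A},\vec a)\in\mathcal{C}$: $(\mathcal{A},\vec a)\models\varphi$ iff $\mathbb{R}_k(\mathcal{A},\vec a)\models\varphi$ (i.e. $\varphi$ is invariant under $k$-generated substructures); (2) there is a sentence $\psi$ of the bounded fragment such that for all $(\mathcal{A},\vec a)\in\mathcal{C}$: $(\mathcal{A},\vec a)\models\varphi$ iff $(\mathcal{A},\vec a)\models\psi$.
   Context: A bounded vocabulary is a pair $(\sigma,\sigma_T)$ where $\sigma$ is a relational vocabulary and $\sigma_T\subseteq\sigma$ consists of binary relation symbols (transition relations). An $m$-pointed $\sigma$-structure is a pair $(\mathcal{A},\vec a)$ with $\mathcal{A}$ a $\sigma$-structure and $\vec a=\langle a_1,\ldots,a_m\rangle\in A^m$; $a_i$ interprets the constant $c_i$. Let $\to$ be the union of the relations $E^{\mathcal{A}}$ for $E\in\sigma_T$. $\mathbb{R}_k(\mathcal{A},\vec a)$ is the induced substructure of $\mathcal{A}$ on the set of elements $b$ such that $a_i\to^{*} b$ by a directed $\to$-path of length at most $k$ for some $1\le i\le m$, with the same tuple $\vec a$. Terms are constants or variables. The bounded fragment consists of formulas generated by $R(t_1,\ldots,t_n)$ ($R\in\sigma$), $t=u$,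 $\neg$, $\wedge$, $\vee$, and the bounded quantifiers $\forall x.[E(t,x)\to\psi]$ and $\exists x.[E(t,x)\wedge\psi]$ with $E\in\sigma_T$ and $x$ distinct from the term $t$. *)

(* Defs.v *)
From mathcomp Require Import all_boot.
From mathcomp Require Import boolp classical_sets functions cardinality.

Set Implicit Arguments.
Unset Strict Implicit.
Unset Printing Implicit Defensive.

Local Open Scope classical_set_scope.

Record vocabulary := Vocabulary {
  symbol :> Type;
  arity : symbol -> nat }.

Record bounded_vocabulary := BoundedVocabulary {
  voc :> vocabulary;
  transition : set (symbol voc);
  transition_binary : forall E, transition E -> arity E = 2 }.

Record structure (s : vocabulary) := Structure {
  carrier :> Type;
  interp : forall R : s, (arity R).-tuple carrier -> Prop }.

Arguments interp {s} A R _ : rename.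

Record pstructure (s : vocabulary) (m : nat) := PStructure {
  base :> structure s;
  point : 'I_m -> base }.

Arguments point {s m} A _ : rename.

Section Syntax.
Variables (s : vocabulary) (m : nat).

(* [Cst i] is the constant symbol interpreted by the i-th point. *)
Inductive term := Var of nat | Cst of 'I_m.

Inductive formula :=
  | Rel (R : s) of (arity R).-tuple term
  | Eq of term & term
  | Neg of formula
  | And of formula & formula
  | Or of formula & formula
  | Imp of formula & formula
  | All of nat & formula
  | Ex of nat & formula.

Definition term_fv (t : term) : seq nat :=
  if t is Var x then [:: x] else [::].

Fixpoint fv (p : formula) : seq nat :=
  match p with
  | Rel R ts => flatten [seq term_fv t | t <- ts]
  | Eq t u => term_fv t ++ term_fv u
  | Neg q => fv q
  | And q r | Or q r | Imp q r => fv q ++ fv r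
  | All x q | Ex x q => [seq y <- fv q | y != x]
  end.

Definition sentence (p : formula) : Prop := fv p = [::].

End Syntax.

Arguments Var {m}.
Arguments Cst {m}.
Arguments Rel {s m}.
Arguments Eq {s m}.
Arguments Neg {s m}.
Arguments And {s m}.
Arguments Or {s m}.
Arguments Imp {s m}.
Arguments All {s m}.
Arguments Ex {s m}.

Section Semantics.
Variables (s : vocabulary) (m : nat) (A : pstructure s m).

Definition eval (v : nat -> A) (t : term m) : A :=
  match t with Var x => v x | Cst i => point A i end.

Definition upd (v : nat -> A) (x : nat) (a : A) : nat -> A :=
  fun y => if y == x then a else v y.

Fixpoint sat (v : nat -> A) (p : formula s m) : Prop :=
  match p with
  | Rel R ts => interp A R (map_tuple (eval v) ts)
  | Eq t u => eval v t = eval v u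
  | Neg q => ~ sat v q
  | And q r => sat v q /\ sat v r
  | Or q r => sat v q \/ sat v r
  | Imp q r => sat v q -> sat v r
  | All x q => forall a, sat (upd v x a) q
  | Ex x q => exists a, sat (upd v x a) q
  end.

(* For a sentence the valuation is irrelevant; one exists as soon as A has
   a point, so the quantifier is not vacuous for 0 < m. *)
Definition models (p : formula s m) : Prop := forall v, sat v p.

End Semantics.

Section Bounded.
Variables (s : bounded_vocabulary) (m : nat).

(* An atom E(t, x) is a tuple of length arity E (which need not be literally
   2), hence it is described through its underlying sequence [:: t; x]. *)
Inductive bounded : formula s m -> Prop :=
  | bounded_rel R ts : bounded (Rel R ts)
  | bounded_eq t u : bounded (Eq t u)
  | bounded_neg p : bounded p -> bounded (Neg p)
  | bounded_and p q : bounded p -> bounded q -> bounded (And p q)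
  | bounded_or p q : bounded p -> bounded q -> bounded (Or p q)
  | bounded_all (E : s) (ts : (arity E).-tuple (term m)) t x p :
      transition E -> tval ts = [:: t; Var x] -> t <> Var x ->
      bounded p -> bounded (All x (Imp (Rel E ts) p))
  | bounded_ex (E : s) (ts : (arity E).-tuple (term m)) t x p :
      transition E -> tval ts = [:: t; Var x] -> t <> Var x ->
      bounded p -> bounded (Ex x (And (Rel E ts) p)).

End Bounded.

Definition induced (s : vocabulary) (A : structure s) (D : set A) :
    structure s :=
  @Structure s {x : A | D x} (fun R xs => interp A R (map_tuple sval xs)).

Section Generated.
Variables (s : bounded_vocabulary) (m : nat).

Definition step (A : structure s) (a b : A) : Prop :=
  exists (E : s) (ab : (arity E).-tuple A),
    [/\ transition E, tval ab = [:: a; b] & interp A E ab].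

Definition reached (k : nat) (A : pstructure s m) : set A :=
  [set b | exists (i : 'I_m) (p : seq A),
    [/\ size p <= k,
        path (fun x y => `[< step x y >]) (point A i) p
      & last (point A i) p = b]].

Arguments reached k A _ : clear implicits.

Lemma point_reached k (A : pstructure s m) i : reached k A (point A i).
Proof. by exists i, [::]. Qed.

Arguments point_reached k A i : clear implicits.

Definition generated (k : nat) (A : pstructure s m) : pstructure s m :=
  @PStructure s m (induced (reached k A))
    (fun i => exist _ (point A i) (point_reached k A i)).

End Generated.

Definition all_pstructures (s : vocabulary) (m : nat) : set (pstructure s m) :=
  [set: pstructure s m].

Definition finite_pstructures (s : vocabulary) (m : nat) :
    set (pstructure s m) :=
  [set A : pstructure s m | finite_set [set: carrier A]].

Arguments all_pstructures s m _ : clear implicits.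
Arguments finite_pstructures s m _ : clear implicits.

(* Main.v *)
Require Import Defs.
From Stdlib Require List.
From mathcomp Require Import all_boot.
From mathcomp Require Import boolp classical_sets functions cardinality.

(** For (2) => (1), a bounded formula of quantifier rank n only ever inspects
elements at distance at most n from the points. For (1) => (2), emptying the
relations that do not occur in [phi] changes neither the truth of [phi] nor
membership in the class; afterwards only finitely many transition relations
are nonempty, so that quantification over the k-generated substructure is a
finite disjunction, over the points and the paths of length at most k, of
iterated bounded quantifiers. Relativizing [phi] in this way gives [psi]. *)

Set Implicit Arguments.
Unset Strict Implicit.
Unset Printing Implicit Defensive.

Local Open Scope classical_set_scope.

Lemma mem_In (T : eqType) (x : T) (l : seq T) : x \in l -> List.In x l.
Proof.
elim: l => //= y l IH; rewrite inE => /orP[/eqP->|/IH]; by [left|right].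
Qed.

Lemma map_tuple_comp_ext (T U V : Type) n (f : U -> V) (g : T -> U)
    (h : T -> V) (ts : n.-tuple T) :
  (forall t, f (g t) = h t) -> map_tuple f (map_tuple g ts) = map_tuple h ts.
Proof. by move=> fgh; apply: val_inj; rewrite /= -map_comp; apply: eq_map. Qed.

Lemma sval_inj (T : Type) (P : T -> Prop) : injective (@sval T P).
Proof. by move=> x y; apply: eq_sig_hprop => z; exact: Prop_irrelevance. Qed.

(** * Truth depends only on the values of the free variables *)

Section Valuations.
Variables (s : vocabulary) (m : nat) (A : pstructure s m).
Implicit Types (v w : nat -> A) (p : formula s m) (t : term m).

Lemma eval_fv v w t : {in term_fv t, v =1 w} -> eval v t = eval w t.
Proof. by case: t => //= x; apply; rewrite mem_head. Qed.

Lemma upd_fv v w x a (l : seq nat) :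
  {in [seq y <- l | y != x], v =1 w} -> {in l, upd v x a =1 upd w x a}.
Proof.
move=> vw y yl; rewrite /upd; case: ifPn => // yx.
by apply: vw; rewrite mem_filter yx.
Qed.

Lemma sat_fv p v w : {in fv p, v =1 w} -> sat v p <-> sat w p.
Proof.
elim: p v w => [R ts|t u|q IH|q IHq r IHr|q IHq r IHr|q IHq r IHr|x q IH|x q IH]
  v w /= vw.
- suff -> : map_tuple (eval v) ts = map_tuple (eval w) ts by [].
  apply: val_inj => /=; elim: (tval ts) vw => //= t l IH vw.
  rewrite IH; last by move=> y yl; apply: vw; rewrite mem_cat yl orbT.
  by rewrite (@eval_fv v w t) // => y yt; apply: vw; rewrite mem_cat yt.
- rewrite (@eval_fv v w t) => [|y yt]; last by apply: vw; rewrite mem_cat yt.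
  by rewrite (@eval_fv v w u) // => y yu; apply: vw; rewrite mem_cat yu orbT.
- by have := IH v w vw; tauto.
1-3: have : {in fv q, v =1 w} by move=> y h; apply: vw; rewrite mem_cat h.
1-3: have : {in fv r, v =1 w} by move=> y h; apply: vw; rewrite mem_cat h orbT.
1-3: by move=> /IHr hr /IHq hq; tauto.
all: have E a := IH _ _ (upd_fv a vw).
- by split=> h a; apply/E/h.
- by split=> -[a h]; exists a; apply/E.
Qed.

Lemma models_sat p v : sentence p -> models A p <-> sat v p.
Proof.
move=> p0; split=> [|vp w]; first exact.
by rewrite (@sat_fv p w v) // p0.
Qed.

End Valuations.

(** * Emptying the relations outside a set of symbols *)

Section Restriction.
Variables (s : vocabulary) (m : nat).

(** Membership in this list is taken as [List.In], since the symbols form an arbitrary type without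
    decidable equality. *)
Fixpoint symbols (p : formula s m) : seq s :=
  match p with
  | Rel R _ => [:: R]
  | Eq _ _ => [::]
  | Neg q | All _ q | Ex _ q => symbols q
  | And q r | Or q r | Imp q r => symbols q ++ symbols r
  end.

(** The carrier is kept, so finiteness is preserved and a valuation in [A] is also one in the
    restricted structure. *)
Definition restrict_symbols (D : set s) (A : pstructure s m) :
    pstructure s m :=
  @PStructure s m (@Structure s A (fun R xs => D R /\ interp A R xs)) (Defs.point A).

Lemma sat_restrict_symbols (D : set s) (A : pstructure s m) p (v : nat -> A) :
  (forall R, List.In R (symbols p) -> D R) ->
  sat (A := restrict_symbols D A) v p <-> sat v p.
Proof.
elim: p v => [R ts|t u|q IH|q IHq r IHr|q IHq r IHr|q IHq r IHr|x q IH|x q IH]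
  v /= DR.
- suff DRR : D R by split=> [[_]|].
  by apply: DR; left.
- by [].
- by have := IH v DR; tauto.
1-3: have := IHq v (fun R h => DR R (List.in_or_app _ _ _ (or_introl h)));
  have := IHr v (fun R h => DR R (List.in_or_app _ _ _ (or_intror h))); tauto.
- by split=> h a; apply/(IH _ DR)/h.
- by split=> -[a h]; exists a; apply/(IH _ DR).
Qed.

End Restriction.

(** * Locality of bounded formulas *)

Section BoundedInvariance.
Variables (s : bounded_vocabulary) (m : nat).

Fixpoint quantifier_rank (p : formula s m) : nat :=
  match p with
  | Rel _ _ | Eq _ _ => 0
  | Neg q => quantifier_rank q
  | And q r | Or q r | Imp q r => maxn (quantifier_rank q) (quantifier_rank r)
  | All _ q | Ex _ q => (quantifier_rank q).+1
  end.

Lemma reached_le (A : pstructure s m) j k (a : A) :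
  j <= k -> reached j a -> reached k a.
Proof.
move=> jk [i [p [pj pp <-]]]; exists i, p; split=> //; exact: leq_trans pj jk.
Qed.

Lemma reached_step (A : pstructure s m) j (a b : A) :
  reached j a -> step a b -> reached j.+1 b.
Proof.
move=> [i [p [pj pp <-]]] ab; exists i, (rcons p b); split.
- by rewrite size_rcons.
- by rewrite rcons_path pp; apply/asboolP.
- by rewrite last_rcons.
Qed.

Variables (k : nat) (A : pstructure s m).
Implicit Types v : nat -> generated k A.

Lemma eval_generated v t : sval (eval v t) = eval (A := A) (fun y => sval (v y)) t.
Proof. by case: t. Qed.

Lemma interp_generated v R (ts : (arity R).-tuple (term m)) :
  interp (generated k A) R (map_tuple (eval v) ts) <->
  interp A R (map_tuple (eval (A := A) (fun y => sval (v y))) ts).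
Proof. by rewrite /= (map_tuple_comp_ext _ (eval_generated v)). Qed.

Lemma upd_generated v x (a : generated k A) :
  (fun y => sval (upd v x a y)) = upd (A := A) (fun y => sval (v y)) x (sval a).
Proof. by apply/funext => y; rewrite /upd; case: ifP. Qed.

(** The guard is an edge from the value of [t] to [a]. As [t] is not the quantified variable, the
    update at [x] leaves its value unchanged, hence within distance [j] of the points. *)
Lemma reached_atom (w : nat -> A) j E (ts : (arity E).-tuple (term m)) t x a :
  transition E -> tval ts = [:: t; Var x] -> t <> Var x ->
  (forall y, reached j (w y)) ->
  interp A E (map_tuple (eval (upd w x a)) ts) -> reached j.+1 a.
Proof.
move=> trE tsE tx wj Ea.
have tj : reached j (eval w t).
  case: t {tsE tx} => //= i; exact: reached_le (point_reached 0 A i).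
apply: (reached_step tj); exists E; eexists; split; [done| |exact: Ea].
rewrite /= tsE /= /upd eqxx; congr [:: _; _].
by case: t tx {tsE tj} => //= y yx; case: eqP => // xy; case: yx; rewrite xy.
Qed.

(** Here [j] bounds the distance of the current values from the points. Each bounded quantifier
    raises [j] by one and lowers the rank by one, so [j + quantifier_rank p <= k] persists and every
    element satisfying a guard lies in the substructure. *)
Lemma sat_bounded_generated p : bounded p ->
  forall j v, j + quantifier_rank p <= k -> (forall y, reached j (sval (v y))) ->
  sat v p <-> sat (A := A) (fun y => sval (v y)) p.
Proof.
elim=> [R ts|t u|q _ IH|q r _ IHq _ IHr|q r _ IHq _ IHr
  |E ts t x q trE tsE tx _ IH|E ts t x q trE tsE tx _ IH] j v /= jk vj.
- exact: interp_generated.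
- rewrite -!eval_generated; split=> [-> //|].
  by move=> h; apply: sval_inj; exact: h.
- by have := IH j v jk vj; tauto.
1-2: have := IHq j v (leq_trans (leq_add (leqnn j) (leq_maxl _ _)) jk) vj;
  have := IHr j v (leq_trans (leq_add (leqnn j) (leq_maxr _ _)) jk) vj; tauto.
all: have jk' : j.+1 + quantifier_rank q <= k
  by rewrite addSnnS; apply: leq_trans jk; rewrite leq_add2l ltnS ?leq_max ?leqnn ?orbT.
all: have updj a : reached j.+1 (sval a) -> forall y, reached j.+1 (sval (upd v x a y))
  by move=> aj y; rewrite /upd; case: ifP => // _; apply: reached_le (vj y).
- split=> h a.
  + move=> Ea; have aj := reached_atom trE tsE tx vj Ea.
    have ak : reached k a by apply: reached_le aj; apply: leq_trans jk'; apply: leq_addr.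
    have := IH _ (upd v x (exist _ a ak)) jk' (updj (exist _ a ak) aj).
    rewrite upd_generated => <-; apply: (h (exist _ a ak)).
    by apply/interp_generated; rewrite upd_generated.
  + move=> /interp_generated; rewrite upd_generated => Ea.
    have aj := reached_atom trE tsE tx vj Ea.
    by apply/(IH _ _ jk' (updj a aj)); rewrite upd_generated; apply: h.
- split=> -[a [Ea qa]].
  + move: Ea => /interp_generated; rewrite upd_generated => Ea.
    have aj := reached_atom trE tsE tx vj Ea.
    exists (sval a); split=> //.
    by rewrite -upd_generated; apply/(IH _ _ jk' (updj a aj)).
  + have aj := reached_atom trE tsE tx vj Ea.
    have ak : reached k a by apply: reached_le aj; apply: leq_trans jk'; apply: leq_addr.
    exists (exist _ a ak); split.
      by apply/interp_generated; rewrite upd_generated.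
    apply/(IH _ _ jk' (updj (exist _ a ak) aj)).
    by rewrite upd_generated.
Qed.

End BoundedInvariance.

(** * Relativizing quantifiers to the generated substructure *)

Section Relativization.
Variables (s : bounded_vocabulary) (m : nat) (i0 : 'I_m).
Local Notation trans_symbol := {E : s | transition E}.

Definition transitions (l : seq s) : seq trans_symbol :=
  pmap (fun E => if pselect (transition E) is left h
                 then Some (exist _ E h) else None) l.

Lemma In_transitions (l : seq s) (E : trans_symbol) :
  List.In E (transitions l) <-> List.In (sval E) l.
Proof.
elim: l => //= F l IH; case: pselect => [h|nh] /=.
  rewrite IH; split=> -[FE|]; try by right.
    by left; rewrite -FE.
  by left; apply: sval_inj; exact: FE.
rewrite IH; split=> [|[FE|//]]; first by right.
by case: nh; rewrite FE; case: E {IH FE}.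
Qed.

(** The arity of a transition symbol is only provably equal to 2, so the pair has to be transported
    along that equality. *)
Definition edge_tuple (T : Type) (E : trans_symbol) (a b : T) :
    (arity (sval E)).-tuple T :=
  tcast (esym (transition_binary (svalP E))) [tuple a; b].

Lemma val_edge_tuple T E (a b : T) : tval (edge_tuple E a b) = [:: a; b].
Proof. exact: val_tcast. Qed.

Lemma map_edge_tuple T U (f : T -> U) E a b :
  map_tuple f (edge_tuple E a b) = edge_tuple E (f a) (f b).
Proof. by apply: val_inj; rewrite /= !val_edge_tuple. Qed.

(** The empty disjunction is falsity, written with a constant to be both bounded and closed. *)
Definition disj (l : seq (formula s m)) : formula s m :=
  foldr Or (Neg (Eq (Cst i0) (Cst i0))) l.

Lemma sat_disj (I : Type) (A : pstructure s m) (w : nat -> A)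
    (f : I -> formula s m) l :
  sat w (disj [seq f i | i <- l]) <-> exists2 i, List.In i l & sat w (f i).
Proof.
elim: l => /= [|i l ->]; first by split=> [[]|[]].
split=> [[fi|[j jl fj]]|[j [->|jl] fj]]; first by exists i => //; left.
- by exists j => //; right.
- by left.
- by right; exists j.
Qed.

Lemma bounded_disj (I : Type) (f : I -> formula s m) l :
  (forall i, bounded (f i)) -> bounded (disj [seq f i | i <- l]).
Proof.
move=> fb; elim: l => /= [|i l IH]; first exact/bounded_neg/bounded_eq.
exact: bounded_or.
Qed.

Definition vars_below d (l : seq nat) : bool := all (fun y => y < d) l.

Lemma vars_below_le d d' l : d <= d' -> vars_below d l -> vars_below d' l.
Proof. by move=> dd'; apply: sub_all => y yd; apply: leq_trans dd'. Qed.

Lemma fv_disj (I : Type) d (f : I -> formula s m) l :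
  (forall i, vars_below d (fv (f i))) ->
  vars_below d (fv (disj [seq f i | i <- l])).
Proof.
move=> fd; elim: l => //= i l IH; rewrite /vars_below all_cat.
by apply/andP; split; first exact: fd.
Qed.

(** * Iterated bounded quantification along paths *)

Section ReachableEx.
Variable S : seq trans_symbol.

(* All variables in use are below [d], so [Var d] is fresh; [F] receives the
   updated bound and the term naming the element reached. *)
Fixpoint reachable_ex n d (t : term m) (F : nat -> term m -> formula s m) :=
  if n is n'.+1 then
    Or (F d t)
       (disj [seq Ex d (And (Rel (sval E) (edge_tuple E t (Var d)))
                            (reachable_ex n' d.+1 (Var d) F)) | E <- S])
  else F d t.

Lemma bounded_reachable_ex n d t F :
  (forall d' u, bounded (F d' u)) -> vars_below d (term_fv t) ->
  bounded (reachable_ex n d t F).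
Proof.
move=> Fb; elim: n d t => //= n IH d t td.
apply: bounded_or => //; apply: bounded_disj => E.
apply: (bounded_ex (t := t)); [exact: svalP|exact: val_edge_tuple| |].
- by move=> tE; move: td; rewrite tE /= ltnn.
- by apply: IH; rewrite /= ltnSn.
Qed.

Lemma fv_reachable_ex n d t F :
  (forall d' u, d <= d' -> vars_below d' (term_fv u) ->
     vars_below d' (fv (F d' u))) ->
  vars_below d (term_fv t) -> vars_below d (fv (reachable_ex n d t F)).
Proof.
elim: n d t => [|n IH] d t Fd td /=; first exact: Fd.
rewrite /vars_below all_cat; apply/andP; split; first exact: Fd.
apply: fv_disj => E /=; rewrite val_edge_tuple /=.
rewrite /vars_below all_filter; apply/allP => y.
have rd : vars_below d.+1 (fv (reachable_ex n d.+1 (Var d) F)).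
  apply: IH => [d' u dd'|]; last by rewrite /= ltnSn.
  by apply: Fd; apply: ltnW.
rewrite !mem_cat mem_seq1 => /orP[/orP[yt|/eqP->]|yr]; apply/implyP=> yd.
- exact: (allP td).
- by rewrite eqxx in yd.
- by have := allP rd y yr; rewrite ltnS leq_eqVlt (negbTE yd).
Qed.

(** The iterated quantifiers assign only variables from [d] on. It therefore suffices that [F]
    expresses [G] at endpoints of short paths, under valuations agreeing with [w] below [d]. *)
Lemma sat_reachable_ex (A : pstructure s m) (R : rel A) n d t F (w : nat -> A)
    (G : A -> Prop) :
  (forall a b, R a b <->
     exists2 E, List.In E S & interp A (sval E) (edge_tuple E a b)) ->
  vars_below d (term_fv t) ->
  (forall p d' u w', size p <= n -> path R (eval w t) p ->
     eval w' u = last (eval w t) p -> d <= d' -> vars_below d' (term_fv u) ->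
     (forall y, y < d -> w' y = w y) ->
     sat w' (F d' u) <-> G (eval w' u)) ->
  sat w (reachable_ex n d t F) <->
  exists p, [/\ size p <= n, path R (eval w t) p & G (last (eval w t) p)].
Proof.
move=> RE; elim: n d t w => [|n IH] d t w td FG /=.
  rewrite (FG [::] d t w) //; split=> [Gt|[p []]]; first by exists [::].
  by rewrite leqn0 => /nilP->.
have tE a : eval (upd w d a) t = eval w t.
  by apply: eval_fv => y /(allP td) yd; rewrite /upd ltn_eqF.
have step_sat a : R (eval w t) a ->
    sat (upd w d a) (reachable_ex n d.+1 (Var d) F) <->
    exists p, [/\ size p <= n, path R a p & G (last a p)].
  move=> ta; have da : eval (upd w d a) (Var d) = a by rewrite /= /upd eqxx.
  rewrite IH ?da //=; last first.
    (* The assumption on [F] for a path [p] from [a] is the one for the path [a :: p] from the value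
       of [t]. *)
    move=> p d' u w' pn pp up dd' ud ww'.
    apply: (FG (a :: p)) => //=; [by rewrite ta|by apply: ltnW|].
    by move=> y yd; rewrite (ww' y (ltnW yd)) /upd ltn_eqF.
  by rewrite ltnSn.
rewrite (FG [::] d t w) // sat_disj; split.
  move=> [Gt|[E ES /= [a [Ea]]]]; first by exists [::].
  rewrite map_edge_tuple tE /= /upd eqxx in Ea.
  have ta : R (eval w t) a by apply/RE; exists E.
  move=> /(step_sat a ta)[p [pn pp Gp]]; exists (a :: p); split=> //=.
  by rewrite ta.
move=> [[|a p] [/= pn pp Gp]]; [by left|right].
case/andP: pp => ta pp; have /RE[E ES Ea] := ta.
exists E => //=; exists a; split; last by apply/(step_sat a ta); exists p.
by rewrite map_edge_tuple tE /= /upd eqxx.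
Qed.

Variable k : nat.

Definition generated_ex d F :=
  disj [seq reachable_ex k d (Cst i) F | i <- enum 'I_m].

Definition term_subst (rho : nat -> term m) (t : term m) : term m :=
  if t is Var x then rho x else t.

Definition subst_upd (rho : nat -> term m) (x : nat) u : nat -> term m :=
  fun y => if y == x then u else rho y.

(** The name of the chosen element, a constant or a fresh variable, differs between the disjuncts,
    so the variables of [p] are replaced by terms through [rho]. Implication is rewritten because
    the bounded fragment lacks it, and a universal quantifier becomes a negated existential one. *)
Fixpoint relativize d (rho : nat -> term m) (p : formula s m) : formula s m :=
  match p with
  | Rel R ts => Rel R (map_tuple (term_subst rho) ts)
  | Eq t u => Eq (term_subst rho t) (term_subst rho u)
  | Neg q => Neg (relativize d rho q)
  | And q r => And (relativize d rho q) (relativize d rho r)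
  | Or q r => Or (relativize d rho q) (relativize d rho r)
  | Imp q r => Or (Neg (relativize d rho q)) (relativize d rho r)
  | All x q =>
      Neg (generated_ex d (fun d' u => Neg (relativize d' (subst_upd rho x u) q)))
  | Ex x q =>
      generated_ex d (fun d' u => relativize d' (subst_upd rho x u) q)
  end.

Lemma bounded_generated_ex d F :
  (forall d' u, bounded (F d' u)) -> bounded (generated_ex d F).
Proof. by move=> Fb; apply: bounded_disj => i; apply: bounded_reachable_ex. Qed.

Lemma bounded_relativize d rho p : bounded (relativize d rho p).
Proof.
elim: p d rho => /= *; do ?[exact: bounded_rel|exact: bounded_eq
  |apply: bounded_and|apply: bounded_or|apply: bounded_neg
  |apply: bounded_generated_ex => *]; by [].
Qed.

Lemma fv_generated_ex d F :
  (forall d' u, d <= d' -> vars_below d' (term_fv u) ->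
     vars_below d' (fv (F d' u))) ->
  vars_below d (fv (generated_ex d F)).
Proof. by move=> Fd; apply: fv_disj => i; apply: fv_reachable_ex. Qed.

Lemma subst_upd_below d d' rho (x : nat) u :
  d <= d' -> (forall y, vars_below d (term_fv (rho y))) ->
  vars_below d' (term_fv u) ->
  forall y, vars_below d' (term_fv (subst_upd rho x u y)).
Proof.
move=> dd' rd ud y; rewrite /subst_upd; case: ifP => // _.
exact: vars_below_le (rd y).
Qed.

(** For [d] equal to 0 no variable is below the bound, so the relativized formula is a sentence. *)
Lemma fv_relativize d rho p :
  (forall y, vars_below d (term_fv (rho y))) ->
  vars_below d (fv (relativize d rho p)).
Proof.
have subst_below d' rho' t : (forall y, vars_below d' (term_fv (rho' y))) ->
    vars_below d' (term_fv (term_subst rho' t)) by case: t => //=.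
elim: p d rho => [R ts|t u|q IH|q IHq r IHr|q IHq r IHr|q IHq r IHr|x q IH|x q IH]
  d rho rd /=; rewrite /vars_below ?all_cat.
- elim: (tval ts) => //= t l IH; rewrite all_cat IH andbT; exact: subst_below.
- by apply/andP; split; apply: subst_below.
- exact: IH.
1-3: by apply/andP; split; [apply: IHq|apply: IHr].
- by apply: fv_generated_ex => d' u dd' ud /=; apply: IH;
  exact (@subst_upd_below d d' rho x u dd' rd ud).
- by apply: fv_generated_ex => d' u dd' ud /=; apply: IH;
  exact (@subst_upd_below d d' rho x u dd' rd ud).
Qed.

(** * Correctness of the relativization *)

Section Correctness.
Variables (D : set s) (A : pstructure s m).
Hypothesis SD : forall E, List.In E S <-> D (sval E).
Local Notation B := (generated k (restrict_symbols D A)).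

(** This is what the restriction is for: afterwards every step uses a symbol of the finite list [S],
    so the disjunctions over [S] miss no path. *)
Lemma step_restrict_symbols (a b : A) :
  `[< step (A := restrict_symbols D A) a b >] <->
  exists2 E, List.In E S & interp A (sval E) (edge_tuple E a b).
Proof.
split=> [/asboolP[E [ab [trE abE [/= DE Eab]]]]|[E ES Eab]].
  exists (exist _ E trE); first exact/SD.
  suff -> : edge_tuple (exist _ E trE) a b = ab by [].
  by apply: val_inj; exact: etrans (val_edge_tuple _ _ _) (esym abE).
apply/asboolP; exists (sval E), (edge_tuple E a b); split.
- exact: svalP.
- exact: val_edge_tuple.
- by split=> //; apply/SD.
Qed.

Lemma sat_generated_ex d F (w : nat -> A) (G : B -> Prop) :
  (forall (b : B) d' u (w' : nat -> A), eval w' u = sval b -> d <= d' ->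
     vars_below d' (term_fv u) -> (forall y, y < d -> w' y = w y) ->
     sat w' (F d' u) <-> G b) ->
  sat w (generated_ex d F) <-> exists b, G b.
Proof.
move=> FG; rewrite sat_disj.
(* [G] lives on the substructure, while [reachable_ex] is evaluated in [A]; [G'] is the image of [G]
   under the inclusion. *)
pose G' (a : A) := exists2 b : B, sval b = a & G b.
have reachE i : sat w (reachable_ex k d (Cst i) F) <->
    exists p, [/\ size p <= k,
      path (fun x y : A => `[< step (A := restrict_symbols D A) x y >])
        (Defs.point A i) p & G' (last (Defs.point A i) p)].
  apply: (sat_reachable_ex (t := Cst i) step_restrict_symbols) => //.
  move=> p d' u w' pk pp up dd' ud ww'.
  have bk : reached (A := restrict_symbols D A) k (eval w' u) by exists i, p.
  rewrite (FG (exist _ (eval w' u) bk)) //; split=> [Gb|[b bu Gb]].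
    by exists (exist _ (eval w' u) bk).
  suff <- : b = exist _ (eval w' u) bk by [].
  by apply: sval_inj; exact: bu.
split=> [[i _ /reachE[p [_ _ [b _ Gb]]]]|[b Gb]]; first by exists b.
have [i [p [pk pp pb]]] := svalP b.
exists i; first by apply: mem_In; rewrite mem_enum.
by apply/reachE; exists p; split=> //; exists b.
Qed.

(** The invariant is that [rho], read under [w], names the values of [v]. It survives the
    quantifiers because the terms of [rho] use only variables below [d], which the fresh variables
    never overwrite. *)
Lemma sat_relativize p d rho (w : nat -> A) (v : nat -> B) :
  (forall R, List.In R (symbols p) -> D R) ->
  (forall y, vars_below d (term_fv (rho y))) ->
  (forall y, eval w (rho y) = sval (v y)) ->
  sat w (relativize d rho p) <-> sat v p.
Proof.
have evalE rho' (w' : nat -> A) (v' : nat -> B) t :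
    (forall y, eval w' (rho' y) = sval (v' y)) ->
    eval w' (term_subst rho' t) = sval (eval v' t) by case: t => //=.
have updE d' rho' (w1 w2 : nat -> A) (v' : nat -> B) x u b :
    (forall y, vars_below d' (term_fv (rho' y))) ->
    (forall y, eval w1 (rho' y) = sval (v' y)) ->
    (forall y, y < d' -> w2 y = w1 y) -> eval w2 u = sval b ->
    forall y, eval w2 (subst_upd rho' x u y) = sval (upd v' x b y).
  move=> rd wv ww ub y; rewrite /subst_upd /upd; case: ifP => // _.
  by rewrite -wv; apply: eval_fv => z /(allP (rd y)); apply: ww.
elim: p d rho w v => [R ts|t u|q IH|q IHq r IHr|q IHq r IHr|q IHq r IHr|x q IH|x q IH]
  d rho w v DR rd wv /=.
- rewrite (map_tuple_comp_ext (h := fun t => sval (eval v t))); last first.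
    by move=> t; apply: evalE.
  rewrite (map_tuple_comp_ext (h := fun t => sval (eval v t))) //.
  have DRR : D R by apply: DR; left.
  by split=> [|[]].
- rewrite !(evalE _ _ v) //; split=> [h|-> //].
  by apply: sval_inj; exact: h.
- by have := IH d rho w v DR rd wv; tauto.
1-3: have := IHq d rho w v (fun R h => DR R (List.in_or_app _ _ _ (or_introl h))) rd wv;
  have := IHr d rho w v (fun R h => DR R (List.in_or_app _ _ _ (or_intror h))) rd wv;
  have := EM (sat v q); tauto.
- rewrite (sat_generated_ex (G := fun b => ~ sat (upd v x b) q)).
    by rewrite -forallNE; split=> h b; have := h b; have := EM (sat (upd v x b) q); tauto.
  move=> b d' u w' ub dd' ud ww' /=.
  rewrite (IH d' _ w' (upd v x b)) //; first
  exact (@subst_upd_below d d' rho x u dd' rd ud).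
  exact: (updE d).
- apply: sat_generated_ex => b d' u w' ub dd' ud ww'.
  by apply: IH => //; [exact (@subst_upd_below d d' rho x u dd' rd ud)|apply: (updE d)].
Qed.

End Correctness.
End ReachableEx.
End Relativization.

(** * The equivalence over all structures and over finite structures *)

Lemma finite_generated (s : bounded_vocabulary) m k (A : pstructure s m) :
  finite_pstructures s m A -> finite_pstructures s m (generated k A).
Proof.
move=> finA; apply: (@finite_preimage _ _ [set: A] sval _ finA).
by move=> a b _ _; apply: sval_inj.
Qed.

Theorem mainTheorem1 (s : bounded_vocabulary) (m : nat) (m_gt0 : 0 < m)
    (C : set (pstructure s m))
    (C_class : C = all_pstructures s m \/ C = finite_pstructures s m)
    (phi : formula s m) (phi_sentence : sentence phi) :
  (exists k : nat, 0 < k /\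
     forall A : pstructure s m, C A ->
       (models A phi <-> models (generated k A) phi)) <->
  (exists psi : formula s m, [/\ bounded psi, sentence psi
     & forall A : pstructure s m, C A -> (models A phi <-> models A psi)]).
Proof.
pose i0 : 'I_m := Ordinal m_gt0.
split=> [[k [_ inv_phi]]|[psi [psi_bounded psi_sentence phi_psi]]].
- pose D : set s := [set R | List.In R (symbols phi)].
  pose S := transitions (symbols phi).
  (* As [phi] is closed, the initial substitution is arbitrary; a constant one contains no variables
     and so permits the bound 0. *)
  pose psi := relativize i0 S k 0 (fun=> Cst i0) phi.
  have psi_sentence : sentence psi.
    have := @fv_relativize s m i0 S k 0 (fun=> Cst i0) phi (fun=> isT).
    by rewrite /sentence -/psi; case: (fv psi).
  exists psi; split=> //; first exact: bounded_relativize.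
  move=> A CA; pose A' := restrict_symbols D A.
  have CA' : C A' by case: C_class CA => ->.
  pose w : nat -> A := fun=> Defs.point A i0.
  pose v : nat -> generated k A' := fun=> Defs.point (generated k A') i0.
  rewrite (models_sat w phi_sentence) (models_sat w psi_sentence).
  (* Invariance is applied to [A'] instead of [A]: truth of [phi] passes from [A] to [A'], then to
     [generated k A'], and there it is expressed by [psi] evaluated in [A]. *)
  rewrite -(@sat_restrict_symbols s m D A phi w) //.
  rewrite -(models_sat (A := A') w phi_sentence) inv_phi //.
  rewrite (models_sat v phi_sentence); apply: iff_sym.
  by apply: sat_relativize => // E; apply: In_transitions.
(* The rank itself suffices for locality; the successor makes [k] positive. *)
- exists (quantifier_rank psi).+1; split=> // A CA.
  set k := (quantifier_rank psi).+1.
  have CkA : C (generated k A).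
    by case: C_class CA => -> //; apply: finite_generated.
  rewrite phi_psi // phi_psi //.
  (* All values of [v] are a point, so the induction on [psi] starts at distance 0. *)
  pose v : nat -> generated k A := fun=> Defs.point (generated k A) i0.
  rewrite (models_sat v psi_sentence).
  rewrite (models_sat (fun y => sval (v y)) psi_sentence).
  apply: iff_sym; apply: (@sat_bounded_generated s m k A psi psi_bounded 0 v).
    exact: leqnSn.
  by move=> y; apply: point_reached.
Qed.
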